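(* Let $(\Delta,\{H_s\}_{s\in\Delta},\Omega)$ be a continuous Hilbert bundle over a Stonean space $\Delta$, let $\{\Delta_i\}_{i\in I}$ be a family of pairwise disjoint clopen subsets of $\Delta$ with dense union, let $c_i=\chi_{\Delta_i}$ and $\Omega_i=\{\omega|_{\Delta_i}:\omega\in\Omega\}$, let $A$ be the Fell algebra of $(\Delta,\{H_s\}_{s\in\Delta},\Omega)$ and $A_i$ the Fell algebra of $(\Delta_i,\{H_s\}_{s\in\Delta_i},\Omega_i)$, and let $\rho:B(\Omega_{\rm wk})\to\bigoplus_i B((\Omega_i)_{\rm wk})$ be the $*$-isomorphism determined by $\rho(b)=(b_i)_i$, where $b_i(\nu|_{\Delta_i})=(b\nu)|_{\Delta_i}$ for $\nu\in\Omega_{\rm wk}$. Then $\rho$ sends $A$ into $\bigoplus_i A_i$, but it need not be true that $A\cong\bigoplus_i A_i$; that is, there exist a Stonean space $\Delta$, a continuous Hilbert bundle $(\Delta,\{H_s\}_{s\in\Delta},\Omega)$ over $\Delta$ and a family $\{\Delta_i\}_{i\in I}$ of pairwise disjoint clopen subsets of $\Delta$ with dense union such that, with $A$ the Fell algebra of $(\Delta,\{H_s\}_{s\in\Delta},\Omega)$ and $A_i$ the Fell algebra of $(\Delta_i,\{H_s\}_{s\in\Delta_i},\Omega_i)$, where $\Omega_i=\{\omega|_{\Delta_i}:\omega\in\Omega\}$, one has $A\not\cong\bigoplus_i A_i$.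
   Context: A Stonean space is a compact, Hausdorff, extremally disconnected space. Inner products are linear in the first variable. Let $T$ be a Stonean space (such as $\Delta$, or a clopen subset $\Delta_i$ of it). A vector field on $T$ with fibres $H_s$ (complex Hilbert spaces) is a function $\nu:T\to\bigsqcup_s H_s$ with $\nu(s)\in H_s$ for all $s$. A continuous Hilbert bundle $(T,\{H_s\}_{s\in T},\Omega)$ consists of a set $\Omega$ of such vector fields such that: (I) $\Omega$ is a $C(T)$-module under $(f\cdot\omega)(s)=f(s)\omega(s)$; (II) $\{\omega(s_0):\omega\in\Omega\}=H_{s_0}$ for every $s_0\in T$; (III) $s\mapsto\|\omega(s)\|$ is continuous for every $\omega\in\Omega$; (IV) $\Omega$ is closed under local uniform approximation: if $\xi$ is a vector field such that for every $s_0\in T$ and $\varepsilon>0$ there are an open set $U\ni s_0$ and $\omega\in\Omega$ with $\|\omega(s)-\xi(s)\|<\varepsilon$ for all $s\in U$, then $\xi\in\Omega$. (With $\Delta_i,\Omega_i$ as in the claim, $(\Delta_i,\{H_s\}_{s\in\Delta_i},\Omega_i)$ is a continuous Hilbert bundle.) A vector field $\nu$ is weakly continuous (with respect to $\Omega$) if $s\mapsto\langle\nu(s),\omega(s)\rangle$ is continuous for every $\omega\in\Omega$. $\Omega_{\rm wk}$ is the set of all weakly continuous $\nu$ with $\sup_s\|\nu(s)\|<\infty$; it is a Hilbert C$^*$-module over $C(T)$ with pointwise action and inner product $\langle\nu_1,\nu_2\rangle$ equal to the unique function in $C(T)$ agreeing with $s\mapsto\langle\nu_1(s),\nu_2(s)\rangle$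 off some meagre set. $(\Omega_i)_{\rm wk}$ denotes this module for the bundle over $\Delta_i$. $B(E)$ is the C$^*$-algebra of adjointable endomorphisms of a Hilbert C$^*$-module $E$. Fell algebra of $(T,\{H_s\}_{s\in T},\Omega)$: the C$^*$-algebra (pointwise operations, norm $\|a\|=\max_s\|a(s)\|$) of all operator fields $a:T\to\bigsqcup_s K(H_s)$, $a(s)\in K(H_s)$ (compact operators), such that $s\mapsto\|a(s)\|$ is continuous, $a$ is weakly continuous (i.e. $s\mapsto\langle a(s)\omega_1(s),\omega_2(s)\rangle$ is continuous for all $\omega_1,\omega_2\in\Omega$), and $a$ is almost finite-dimensional: for every $s_0\in T$, $\varepsilon>0$ there are an open $U\ni s_0$ and $\omega_1,\dots,\omega_n\in\Omega$ with $\omega_1(s),\dots,\omega_n(s)$ linearly independent for every $s\in U$ and $\|p_sa(s)p_s-a(s)\|<\varepsilon$ for all $s\in U$, where $p_s$ is the projection of $H_s$ onto $\mathrm{Span}\{\omega_j(s):1\le j\le n\}$. The Fell algebra is regarded as a C$^*$-subalgebra of $B(\Omega_{\rm wk})$ via $(a\nu)(s)=a(s)\nu(s)$ (and $A_i\subset B((\Omega_i)_{\rm wk})$ likewise). $\bigoplus_{i}B_i$ denotes the $\ell^\infty$-direct sum of C$^*$-algebras: all families $(b_i)_i$, $b_i\in B_i$, with $\sup_i\|b_i\|<\infty$; $\cong$ means $*$-isomorphic. *)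

(* Defs.v *)
From HB Require Import structures.
From mathcomp Require Import all_boot all_order all_algebra.
From mathcomp Require Import complex.
From mathcomp Require Import all_classical all_reals all_analysis.

Set Implicit Arguments.
Unset Strict Implicit.
Unset Printing Implicit Defensive.

Import Order.TTheory GRing.Theory Num.Theory numFieldNormedType.Exports.

Local Open Scope classical_set_scope.
Local Open Scope ring_scope.
Local Open Scope complex_scope.

(* Complex scalars are R[i] for R : realType; its topology is only declared on
   the alias R[i]^o, hence the codomains R[i]^o below. *)

Definition extremally_disconnected (T : topologicalType) : Prop :=
  forall U : set T, open U -> open (closure U).

Definition stonean (T : topologicalType) : Prop :=
  [/\ compact [set: T], hausdorff_space T & extremally_disconnected T].

Definition nowhere_dense (T : topologicalType) (N : set T) : Prop :=
  (closure N)° = set0.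

Definition meagre (T : topologicalType) (M : set T) : Prop :=
  exists2 N : nat -> set T,
    forall n, nowhere_dense (N n) & M `<=` \bigcup_n N n.

(* Positivity and definiteness of the inner product follow from inner_norm. *)
HB.mixin Record CompleteNormedModule_isHilbert (R : realType) V
    & CompleteNormedModule R[i] V := {
  inner : V -> V -> R[i] ;
  inner_linear : forall (c : R[i]) (x y z : V),
    inner (c *: x + y) z = c * inner x z + inner y z ;
  inner_conj : forall x y : V, inner y x = (inner x y)^* ;
  inner_norm : forall x : V, inner x x = `|x| ^+ 2
}.

#[short(type="hilbertType")]
HB.structure Definition Hilbert (R : realType) :=
  {V of CompleteNormedModule R[i] V & CompleteNormedModule_isHilbert R V}.

Section Operators.
Context {R : realType} {H : hilbertType R}.
Implicit Types (f g p : H -> H) (V : set H).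

(* The library norm `|x| lives in R[i]. *)
Definition hnorm (x : H) : R := complex.Re `|x|.

Lemma innerD (x y z : H) : inner (x + y) z = inner x z + inner y z.
Proof. by rewrite -[x]scale1r inner_linear mul1r scale1r. Qed.

Lemma inner0l (z : H) : inner 0 z = 0.
Proof. by apply: (addrI (inner 0 z)); rewrite -innerD !addr0. Qed.

Lemma innerZ (c : R[i]) (x z : H) : inner (c *: x) z = c * inner x z.
Proof. by rewrite -[c *: x]addr0 inner_linear inner0l addr0. Qed.

Lemma hnormE (x : H) : `|x| = (hnorm x)%:C.
Proof. by rewrite /hnorm RRe_real ?normr_real. Qed.

Lemma hnormD (x y : H) : hnorm (x + y) <= hnorm x + hnorm y.
Proof. by rewrite -lecR rmorphD/= -!hnormE ler_normD. Qed.

Lemma hnormZ (c : R[i]) (x : H) : hnorm (c *: x) = complex.Re `|c| * hnorm x.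
Proof. by rewrite /hnorm normrZ hnormE /= mulr0 subr0. Qed.

Lemma Re_norm_ge0 (c : R[i]) : 0 <= complex.Re `|c|.
Proof. by have := normr_ge0 c; rewrite lecE => /andP[]. Qed.

(* This sup is taken over a bounded set whenever f is a bounded operator. *)
Definition opnorm f : R := sup [set hnorm (f x) | x in [set x | hnorm x <= 1]].

Definition compact_op f : Prop :=
  linear f /\ precompact (f @` [set x | hnorm x <= 1]).

Definition is_adjoint f g : Prop := forall x y, inner (f x) y = inner x (g y).

Definition span_of n (v : 'I_n -> H) : set H :=
  [set x | exists c : 'I_n -> R[i], x = \sum_(j < n) c j *: v j].

Definition lin_indep n (v : 'I_n -> H) : Prop :=
  forall c : 'I_n -> R[i], \sum_(j < n) c j *: v j = 0 -> forall j, c j = 0.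

Definition is_proj_onto V p : Prop :=
  forall x, V (p x) /\ forall y, V y -> inner (x - p x) y = 0.

End Operators.

Definition vfield (R : realType) (T : Type) (H : T -> hilbertType R) : Type :=
  forall s, H s.

Definition opfield (R : realType) (T : Type) (H : T -> hilbertType R) : Type :=
  forall s, H s -> H s.

Section Bundles.
Context {R : realType} {T : topologicalType} {H : T -> hilbertType R}.
Implicit Types (Om : set (vfield H)) (a : opfield H).

Record continuous_hilbert_bundle Om : Prop := ContinuousHilbertBundle {
  chb_zero : Om (fun=> 0) ;
  chb_add : forall w1 w2, Om w1 -> Om w2 -> Om (fun s => w1 s + w2 s) ;
  chb_scale : forall (f : T -> R[i]^o) w,
    continuous f -> Om w -> Om (fun s => f s *: w s) ;
  chb_fibre : forall s0 (x : H s0), exists2 w, Om w & w s0 = x ;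
  chb_norm : forall w, Om w -> continuous (fun s => hnorm (w s)) ;
  chb_closed : forall xi : vfield H,
    (forall s0 (e : R), 0 < e -> exists U w,
      [/\ open U, U s0, Om w & forall s, U s -> hnorm (w s - xi s) < e]) ->
    Om xi
}.

Definition weakly_continuous Om (nu : vfield H) : Prop := forall w, Om w ->
  continuous (fun s => inner (nu s) (w s) : R[i]^o).

Definition Omega_wk Om : set (vfield H) :=
  [set nu | weakly_continuous Om nu /\
            exists M : R, forall s, hnorm (nu s) <= M].

(* The unique continuous function agreeing with the pointwise inner product off
   a meagre set; the default value of xget is never used on Omega_wk when T is
   Stonean and Om is a continuous Hilbert bundle. *)
Definition wk_inner (nu1 nu2 : vfield H) : T -> R[i]^o :=
  xget (fun=> 0) [set f : T -> R[i]^o | continuous f /\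
    exists2 M, meagre M & forall s, ~ M s -> f s = inner (nu1 s) (nu2 s)].

Definition wk_norm (nu : vfield H) : R :=
  Num.sqrt (sup [set complex.Re `|wk_inner nu nu s| | s in [set: T]]).

(* n = 0 is allowed (the span is then 0), so fibres may be zero spaces. *)
Definition almost_finite_dimensional Om a : Prop :=
  forall s0 (e : R), 0 < e ->
  exists (U : set T) (n : nat) (w : 'I_n -> vfield H) (p : opfield H),
    [/\ open U, U s0, forall j, Om (w j) &
        forall s, U s ->
        [/\ lin_indep (fun j => w j s), is_proj_onto (span_of (fun j => w j s)) (p s)
          & opnorm (fun x => p s (a s (p s x)) - a s x) < e]].

Definition fell Om : set (opfield H) :=
  [set a | [/\ forall s, compact_op (a s),
               continuous (fun s => opnorm (a s)),
               forall w1 w2, Om w1 -> Om w2 ->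
                 continuous (fun s => inner (a s (w1 s)) (w2 s) : R[i]^o)
             & almost_finite_dimensional Om a]].

Lemma Omega_wkD Om (nu1 nu2 : vfield H) : Omega_wk Om nu1 -> Omega_wk Om nu2 ->
  Omega_wk Om (fun s => nu1 s + nu2 s).
Proof.
move=> [c1 [M1 h1]] [c2 [M2 h2]]; split=> [w ww x|].
  under [X in continuous_at _ X]eq_fun do rewrite innerD.
  exact: (continuousD (c1 w ww x) (c2 w ww x)).
exists (M1 + M2) => s.
exact: le_trans (hnormD _ _) (lerD (h1 s) (h2 s)).
Qed.

Lemma Omega_wkZ Om (c : R[i]) (nu : vfield H) : Omega_wk Om nu ->
  Omega_wk Om (fun s => c *: nu s).
Proof.
move=> [c1 [M h]]; split=> [w ww x|].
  under [X in continuous_at _ X]eq_fun do rewrite innerZ.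
  exact: (@continuousZl_tmp _ R[i]^o _ _ c x (c1 w ww x)).
exists (complex.Re `|c| * M) => s.
by rewrite hnormZ ler_wpM2l// Re_norm_ge0.
Qed.

Definition wk_module Om : Type := {nu : vfield H | Omega_wk Om nu}.

Definition wk_field Om (nu : wk_module Om) : vfield H := proj1_sig nu.

Definition wk_add Om (nu1 nu2 : wk_module Om) : wk_module Om :=
  exist _ _ (Omega_wkD (proj2_sig nu1) (proj2_sig nu2)).

Definition wk_scale Om (c : R[i]) (nu : wk_module Om) : wk_module Om :=
  exist _ _ (Omega_wkZ c (proj2_sig nu)).

Definition wk_adjoint Om (b c : wk_module Om -> wk_module Om) : Prop :=
  forall nu mu : wk_module Om, wk_inner (wk_field (b nu)) (wk_field mu) =
                wk_inner (wk_field nu) (wk_field (c mu)).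

Definition adjointable Om : set (wk_module Om -> wk_module Om) :=
  [set b | exists c, wk_adjoint b c].

Definition wk_opnorm Om (b : wk_module Om -> wk_module Om) : R :=
  sup [set wk_norm (wk_field (b nu)) | nu in
        [set nu : wk_module Om | wk_norm (wk_field nu) <= 1]].

(* The image of the Fell algebra under (a nu)(s) = a(s) nu(s). *)
Definition fell_ops Om : set (wk_module Om -> wk_module Om) :=
  [set b | adjointable b /\ exists2 a, fell Om a &
     forall nu s, wk_field (b nu) s = a s (wk_field nu s)].

End Bundles.

Section Restriction.
Context {R : realType} {T : topologicalType} {H : T -> hilbertType R}.
Variable D : set T.

Definition restr_fibres (s : D) : hilbertType R := H (set_val s).

Definition restr_field (nu : vfield H) : vfield restr_fibres :=
  fun s => nu (set_val s).

Definition restr_bundle (Om : set (vfield H)) : set (vfield restr_fibres) :=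
  restr_field @` Om.

Lemma Omega_wk_restr Om (nu : vfield H) : Omega_wk Om nu ->
  Omega_wk (restr_bundle Om) (restr_field nu).
Proof.
move=> [c1 [M h]]; split=> [_ [w ww <-] x|]; last by exists M => s; exact: h.
have := @continuous_comp _ _ _ set_val (fun s => inner (nu s) (w s) : R[i]^o) x.
by apply; [exact: initial_continuous|exact: c1].
Qed.

Definition wk_restr Om (nu : wk_module Om) : wk_module (restr_bundle Om) :=
  exist _ _ (Omega_wk_restr (proj2_sig nu)).

End Restriction.
Arguments restr_bundle {R T H} D Om.

(* A concrete *-algebra: a subset sa_set of an ambient type carrying the
   operations (closure of sa_set under them is not part of the data). The
   involution is given by its graph: sa_adj a b means b = a^*. *)
Record starAlg (R : realType) := StarAlg {
  sa_sort : Type ;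
  sa_set : set sa_sort ;
  sa_add : sa_sort -> sa_sort -> sa_sort ;
  sa_scale : R[i] -> sa_sort -> sa_sort ;
  sa_mul : sa_sort -> sa_sort -> sa_sort ;
  sa_adj : sa_sort -> sa_sort -> Prop ;
  sa_norm : sa_sort -> R
}.
Arguments sa_set {R} s _ : rename.

Section StarAlgebras.
Context {R : realType}.
Implicit Types A B : starAlg R.

Definition star_isomorphism A B (phi : sa_sort A -> sa_sort B) : Prop :=
  [/\ set_bij (sa_set A) (sa_set B) phi,
      forall a b, sa_set A a -> sa_set A b ->
        phi (sa_add a b) = sa_add (phi a) (phi b),
      forall c a, sa_set A a -> phi (sa_scale c a) = sa_scale c (phi a),
      forall a b, sa_set A a -> sa_set A b ->
        phi (sa_mul a b) = sa_mul (phi a) (phi b)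
    & forall a b, sa_set A a -> sa_set A b ->
        sa_adj a b -> sa_adj (phi a) (phi b)].

Definition star_isomorphic A B : Prop :=
  exists phi : sa_sort A -> sa_sort B, star_isomorphism phi.

Definition linf_sum (I : Type) (B : I -> starAlg R) : starAlg R := {|
  sa_sort := forall i, sa_sort (B i) ;
  sa_set := [set b | (forall i, sa_set (B i) (b i)) /\
                     exists M : R, forall i, sa_norm (b i) <= M] ;
  sa_add := fun a b i => sa_add (a i) (b i) ;
  sa_scale := fun c a i => sa_scale c (a i) ;
  sa_mul := fun a b i => sa_mul (a i) (b i) ;
  sa_adj := fun a b => forall i, sa_adj (a i) (b i) ;
  sa_norm := fun a => sup [set sa_norm (a i) | i in [set: I]]
|}.

Definition sub_starAlg B (S : set (sa_sort B)) : starAlg R := {|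
  sa_sort := sa_sort B ;
  sa_set := S ;
  sa_add := @sa_add R B ;
  sa_scale := @sa_scale R B ;
  sa_mul := @sa_mul R B ;
  sa_adj := @sa_adj R B ;
  sa_norm := @sa_norm R B
|}.

Context {T : topologicalType} {H : T -> hilbertType R}.
Implicit Types Om : set (vfield H).

Definition fell_algebra Om : starAlg R := {|
  sa_sort := opfield H ;
  sa_set := fell Om ;
  sa_add := fun a b s x => a s x + b s x ;
  sa_scale := fun c a s x => c *: a s x ;
  sa_mul := fun a b s x => a s (b s x) ;
  sa_adj := fun a b => forall s, is_adjoint (a s) (b s) ;
  sa_norm := fun a => sup [set opnorm (a s) | s in [set: T]]
|}.

(* B(Omega_wk). *)
Definition wk_algebra Om : starAlg R := {|
  sa_sort := wk_module Om -> wk_module Om ;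
  sa_set := @adjointable R T H Om ;
  sa_add := fun a b nu => wk_add (a nu) (b nu) ;
  sa_scale := fun c a nu => wk_scale c (a nu) ;
  sa_mul := fun a b nu => a (b nu) ;
  sa_adj := @wk_adjoint R T H Om ;
  sa_norm := @wk_opnorm R T H Om
|}.

(* The Fell algebra regarded as a subalgebra of B(Omega_wk). *)
Definition fell_subalgebra Om : starAlg R :=
  @sub_starAlg (wk_algebra Om) (@fell_ops R T H Om).

Definition disjoint_clopen_dense (I : Type) (D : I -> set T) : Prop :=
  [/\ forall i, clopen (D i), trivIset [set: I] D & dense (\bigcup_i D i)].

End StarAlgebras.

(* Main.v *)
Require Import Defs.
From HB Require Import structures.
From mathcomp Require Import all_boot all_order all_algebra.
From mathcomp Require Import complex lra.
From mathcomp Require Import all_classical all_reals all_analysis.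

Set Implicit Arguments.
Unset Strict Implicit.
Unset Printing Implicit Defensive.

Import Order.TTheory GRing.Theory Num.Theory numFieldNormedType.Exports.

Local Open Scope classical_set_scope.
Local Open Scope ring_scope.
Local Open Scope complex_scope.

(** The map [rho] cuts an operator on the global module down to the pieces
    [D i].  When [b] acts fibrewise through a field [a] of the Fell algebra,
    [rho b i] acts through the restriction of [a] to [D i], and each condition
    defining the Fell algebra survives restriction ([fell_restr]).  Every
    weakly continuous field on a clopen [D i] is the restriction of its
    extension by zero ([Omega_wk_extend0]), so the formula for [rho] on
    restricted fields determines [rho b i] completely.  Adjointability and the
    uniform bound come with the codomain of [rho].

    For the second half, the dimension of the fibres is made to drop on the
    nowhere dense set that the clopen pieces leave out.  Over the Stone-Cech
    compactification of the natural numbers, seen as the space of ultrafilters,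
    put a one-dimensional fibre over each principal ultrafilter and the zero
    space over each free one.  The continuous sections are the continuous
    functions that vanish at every free ultrafilter, that is, the sequences
    tending to 0.  A field of the Fell algebra has continuous norm, and this
    norm vanishes at the free points, so the Fell algebra is c_0.  The principal
    points are isolated with dense union; over each of them the Fell algebra is
    the scalars, and the l^oo-sum of these is l^oo.  The second algebra has a
    unit and the first has none: a unit would have norm 1 on a dense set and
    norm 0 at a free ultrafilter ([fell_c0_sections_not_isomorphic_sum]). *)

(** * Restriction of fields to a clopen subset *)

Section Restriction.
Context {R : realType} {T : topologicalType} {H : T -> hilbertType R}.
Variable D : set T.
Implicit Types (Om : set (vfield H)) (a : opfield H).

Lemma continuous_restr (U : topologicalType) (f : T -> U) :
  continuous f -> continuous (fun s : D => f (set_val s)).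
Proof.
move=> cf s.
apply: (@continuous_comp _ _ _ (set_val : D -> T) f); last exact: cf.
exact: initial_continuous.
Qed.

Definition restr_opfield a : opfield (@restr_fibres R T H D) :=
  fun s => a (set_val s).

Lemma fell_restr Om a : fell Om a -> fell (restr_bundle D Om) (restr_opfield a).
Proof.
move=> [ka na wa fa]; split=> [s|||s0 e e0].
- exact: ka.
- exact: (continuous_restr na).
- move=> _ _ [w1 Ow1 <-] [w2 Ow2 <-].
  exact: (continuous_restr (wa _ _ Ow1 Ow2)).
- have [U [n [w [p [oU Us0 Ow wU]]]]] := fa (set_val s0) e e0.
  exists (set_val @^-1` U), n, (fun j => restr_field (w j)),
    (fun s => p (set_val s)); split=> [||j|s Us].
  + by move/continuousP: (@initial_continuous _ _ (set_val : D -> T)); apply.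
  + exact: Us0.
  + by exists (w j).
  + exact: wU.
Qed.

(** The test on [D t] is a proof-carrying one: in the first branch the proof is
    what makes [t] a point of the subspace, hence [nu] applicable. *)
Definition extend0 (nu : vfield (@restr_fibres R T H D)) : vfield H :=
  fun t => match pselect (D t) with
           | left Dt => nu (exist _ t (mem_set Dt))
           | right _ => 0
           end.

Lemma extend0K nu : restr_field (extend0 nu) = nu.
Proof.
apply: functional_extensionality_dep => -[t Dt].
rewrite /restr_field /extend0 /=; case: pselect => [Dt'|]; last first.
  by case; exact: set_mem Dt.
by rewrite (bool_irrelevance (mem_set Dt') Dt).
Qed.

(** Openness of [D] gives continuity at the points of [D], where the extension
    locally is [nu], and closedness gives it off [D], where it locally is 0. *)
Lemma Omega_wk_extend0 Om (nu : vfield (@restr_fibres R T H D)) :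
  clopen D -> Omega_wk (restr_bundle D Om) nu -> Omega_wk Om (extend0 nu).
Proof.
move=> [oD cD] [wnu [M nuM]]; split=> [w Ow x A|]; last first.
  exists (Num.max M 0) => t; rewrite /extend0; case: pselect => [Dt|_].
    by rewrite le_max nuM.
  by rewrite le_max /hnorm normr0 lexx orbT.
have [Dx|nDx] := pselect (D x); last first.
  have ext0 t : ~ D t -> inner (extend0 nu t) (w t) = 0.
    by rewrite /extend0; case: pselect => // _ _; rewrite inner0l.
  rewrite ext0 // => /nbhs_singleton A0.
  apply: filterS (open_nbhs_nbhs (conj (closed_openC cD) nDx)) => t nDt /=.
  by rewrite ext0.
have /(_ (exist _ x (mem_set Dx)) A) := wnu _ (ex_intro2 _ _ w Ow erefl).
have extD (s : D) : inner (extend0 nu (set_val s)) (w (set_val s)) =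
    inner (nu s) (restr_field w s).
  by rewrite -[in RHS](extend0K nu).
rewrite -(extD (exist _ x (mem_set Dx))) => /[apply].
rewrite nbhsE => -[_ [[V oV <-] Vx] VA].
suff : nbhs x (V `&` D).
  apply: filterS => t [Vt Dt] /=.
  rewrite (extD (exist _ t (mem_set Dt))).
  exact: (VA (exist _ t (mem_set Dt))).
apply: open_nbhs_nbhs; split; first exact: openI.
by split.
Qed.

End Restriction.
Arguments restr_opfield {R T H D} a s x.

(** The formula for [rho b i] on restricted fields is all there is to know about
    [rho b i], because restriction to a clopen set is onto the local module. *)
Lemma restriction_map_fell (R : realType) (T : topologicalType)
     (H : T -> hilbertType R) (Om : set (vfield H)) (I : Type) (D : I -> set T)
     (rho : sa_sort (wk_algebra Om) ->
            sa_sort (linf_sum (fun i => wk_algebra (restr_bundle (D i) Om)))) :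
     (forall i, clopen (D i)) ->
     star_isomorphism rho ->
     (forall b, sa_set (wk_algebra Om) b ->
        forall i (nu : wk_module Om),
          rho b i (wk_restr (D i) nu) = wk_restr (D i) (b nu)) ->
     forall b, sa_set (fell_subalgebra Om) b ->
       sa_set (linf_sum (fun i => fell_subalgebra (restr_bundle (D i) Om)))
              (rho b).
Proof.
move=> cD [[rhoS _ _] _ _ _ _] rhoE b [adjb [a fa ba]].
have [adjr bndr] := rhoS _ adjb.
split=> [i|]; last exact: bndr.
split; first exact: adjr.
exists (@restr_opfield _ _ _ (D i) a); first exact: fell_restr.
move=> nu s.
pose nu' : wk_module Om := exist _ _ (Omega_wk_extend0 (cD i) (proj2_sig nu)).
have nuE : nu = wk_restr (D i) nu'.
  apply: eq_sig_hprop => /=; first by move=> *; exact: Prop_irrelevance.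
  exact/esym/extend0K.
rewrite {1}nuE rhoE // [in RHS]nuE.
exact: ba.
Qed.

(** * Topology of the complex numbers *)

Section ComplexCompact.
Context {R : realType}.
Implicit Types z : R[i].

(** In the order of the complex numbers, being positive includes being real;
    this is how radii of balls become real numbers. *)
Lemma gtc0_real z : (0 < z) -> 0 < complex.Re z /\ z = (complex.Re z)%:C.
Proof.
case: z => x y; rewrite ltcE /= => /andP[/eqP-> x0]; split=> //.
Qed.

Lemma normc_real (x : R) : `|x%:C| = `|x|%:C.
Proof. by rewrite normc_def /= expr0n /= addr0 sqrtr_sqr. Qed.

Lemma real_complex_continuous : continuous (fun x : R => x%:C : R[i]^o).
Proof.
move=> x; apply/cvgrPdist_lt => e /gtc0_real[e0 ->].
near=> y.
rewrite -rmorphB normc_real ltcR.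
near: y; exact: cvgr_dist_lt cvg_id _ e0.
Unshelve. all: by end_near. Qed.

Lemma Re_continuous : continuous (fun z : R[i]^o => complex.Re z).
Proof.
move=> z; have FF := nbhs_filter (z : R[i]^o); apply/cvgrPdist_lt => e e0.
have eC0 : 0 < e%:C by rewrite ltcR.
apply: (@filterS _ _ FF _ _ _ (@cvgr_dist_lt _ R[i]^o _ _ FF id z cvg_id _ eC0)).
move=> w /=; rewrite -ltcR; apply: le_lt_trans.
by have := normc_ge_Re (z - w); case: (z) (w) => [? ?] [? ?].
Qed.

Lemma closed_disk_compact (r : R) :
  compact [set z : R[i]^o | complex.Re `|z| <= r].
Proof.
(* The disk is a closed part of the image of a square under (x, y) |-> x + iy. *)
pose f (u : R * R) : R[i]^o := u.1%:C + u.2%:C *: ('i : R[i]^o).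
have cf : continuous f.
  move=> u; apply: (@cvgD _ R[i]^o _ _ _ (fun u : R * R => u.1%:C : R[i]^o)
    (fun u => u.2%:C *: ('i : R[i]^o))).
    apply: (@continuous_comp _ _ R[i]^o fst (fun x : R => x%:C : R[i]^o)).
      exact: cvg_fst.
    exact: real_complex_continuous.
  apply: (@cvgZr_tmp R[i] R[i]^o).
  apply: (@continuous_comp _ _ R[i]^o snd (fun x : R => x%:C : R[i]^o)).
    exact: cvg_snd.
  exact: real_complex_continuous.
apply: (@subclosed_compact _ _ (f @` (`[-r, r] `*` `[-r, r]))).
- rewrite (_ : mkset _ =
      (fun z : R[i]^o => complex.Re `|z|) @^-1` [set x | x <= r]) //.
  apply: closed_comp; last exact: closed_le.
  move=> z _; apply: (@continuous_comp _ R[i]^o _ (fun z : R[i]^o => `|z|)).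
    exact: (@norm_continuous R[i] R[i]^o).
  exact: Re_continuous.
- apply: continuous_compact; first exact: continuous_subspaceT.
  by apply: compact_setX; exact: segment_compact.
- move=> [x y] /= xyr; exists (x, y).
    rewrite /= !in_itv /= -!ler_norml; split; apply: le_trans xyr;
    rewrite -sqrtr_sqr ler_wsqrtr //.
      by rewrite lerDl sqr_ge0.
    by rewrite lerDr sqr_ge0.
  rewrite /f /= [_ *: _]mulrC; exact/esym/complexE.
Qed.
End ComplexCompact.

Section ComplexContinuity.
Context {R : realType} {T : topologicalType}.
Implicit Types f g : T -> R[i]^o.

Lemma complex_continuousD f g :
  continuous f -> continuous g -> continuous (fun s => f s + g s).
Proof. by move=> cf cg s; apply: (@cvgD _ R[i]^o); [exact: cf|exact: cg]. Qed.

Lemma complex_continuousM f g :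
  continuous f -> continuous g -> continuous (fun s => f s * g s).
Proof. by move=> cf cg s; apply: (@cvgM R[i]); [exact: cf|exact: cg]. Qed.

Lemma complex_continuous_norm f :
  continuous f -> continuous (fun s => complex.Re `|f s|).
Proof.
move=> cf s.
apply: (@continuous_comp _ R[i]^o _ (fun s => `|f s| : R[i]^o)
   (fun z : R[i]^o => complex.Re z)); last exact: Re_continuous.
apply: (@continuous_comp _ R[i]^o _ _ (fun z : R[i]^o => `|z|)); first exact: cf.
exact: (@norm_continuous R[i] R[i]^o).
Qed.

Lemma Re_normD (y z : R[i]) :
  complex.Re `|y + z| <= complex.Re `|y| + complex.Re `|z|.
Proof.
have nE (x : R[i]) : (complex.Re `|x|)%:C = `|x| by rewrite RRe_real ?normr_real.
by rewrite -lecR rmorphD /= !nE ler_normD.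
Qed.

Lemma local_uniform_limit_continuous f :
  (forall s0 (e : R), 0 < e -> exists U g,
     [/\ open U, U s0, continuous g &
         forall s, U s -> complex.Re `|g s - f s| < e]) ->
  continuous f.
Proof.
move=> fP s0; apply/cvgrPdist_lt => e /gtc0_real[e0 eE].
have e3 : 0 < complex.Re e / 3 by rewrite divr_gt0.
have [U [g [oU Us0 cg gf]]] := fP s0 _ e3.
have cn : continuous (fun s => complex.Re `|g s0 - g s|).
  apply: (@complex_continuous_norm (fun s => g s0 - g s)) => s.
  by apply: (@cvgB _ R[i]^o); [exact: cvg_cst|exact: cg].
have := cn s0; move=> /cvgrPdist_lt/(_ _ e3); rewrite subrr normr0 /=.
have := open_nbhs_nbhs (conj oU Us0); apply: filterS2 => s Us.
rewrite sub0r normrN ger0_norm ?Re_norm_ge0 // => gs.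
rewrite eE -(RRe_real (normr_real _)) ltcR.
have -> : f s0 - f s = - (g s0 - f s0) + ((g s0 - g s) + (g s - f s)).
  by rewrite opprB !subrKA.
apply: le_lt_trans (Re_normD _ _) _; rewrite normrN.
set d := complex.Re e / 3 in e3 gf gs *.
have -> : complex.Re e = d + (d + d) by rewrite /d; lra.
apply: ltrD; first exact: gf.
by apply: le_lt_trans (Re_normD _ _) _; apply: ltrD; [exact: gs|exact: gf].
Qed.

End ComplexContinuity.

(** * Hilbert spaces of dimension 0 or 1 *)

(** Row vectors of length [b], the boolean read as 0 or 1: a single family of
    types thus contains the scalars and the zero space, and a bundle may switch
    between them without casts.  The supremum norm of row vectors is Hilbertian
    in these two dimensions. *)
Definition fibre (R : realType) (b : bool) := 'rV[R[i]^o]_b.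

HB.instance Definition _ (R : realType) (b : bool) :=
  NormedModule.copy (fibre R b) 'rV[R[i]^o]_b.

(** The coordinate of the vector, with value 0 on the zero space. *)
Definition fcoord (R : realType) (b : bool) (x : fibre R b) : R[i]^o :=
  \sum_j (x : 'rV[R[i]^o]_b) 0 j.
Arguments fcoord {R b} x : rename.

Definition fone (R : realType) (b : bool) : fibre R b := const_mx 1.
Arguments fone {R b}.

Lemma fibreE (R : realType) (b : bool) (x : fibre R b) : x = fcoord x *: fone.
Proof.
rewrite /fcoord /fone; case: b x => x; apply/rowP => -[[|//] j] //.
rewrite big_ord1 !mxE [RHS]mulr1; congr ((x : 'rV__) _ _); exact: val_inj.
Qed.

Lemma norm_fone (R : realType) : `|fone : fibre R true| = 1.
Proof.
have one0 : (fone : fibre R true) != 0.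
  by apply/eqP => /rowP/(_ 0)/eqP; rewrite !mxE oner_eq0.
have n0 : mx_norm (fone : 'rV[R[i]^o]_true) != 0.
  by apply: contra_neq one0; exact: mx_norm_eq0.
have [k] := mx_norm_neq0 n0.
by rewrite mxE normr1 => n1; exact: n1.
Qed.

Lemma norm_fcoord (R : realType) (b : bool) (x : fibre R b) : `|x| = `|fcoord x|.
Proof.
case: b x => x; first by rewrite {1}(fibreE x) normrZ norm_fone mulr1.
rewrite /fcoord big_ord0 normr0; apply/eqP; rewrite normr_eq0.
by apply/eqP/rowP => -[].
Qed.

Section Fibre.
Context {R : realType} {b : bool}.
Implicit Types x y : fibre R b.

Lemma fcoord_linear : linear (@fcoord R b).
Proof.
move=> c x y; rewrite /fcoord scaler_sumr -big_split /=.
by apply: eq_bigr => j _; rewrite !mxE.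
Qed.

HB.instance Definition _ := GRing.isLinear.Build R[i] (fibre R b) R[i]^o _
  (@fcoord R b) fcoord_linear.

Lemma fcoord_one : b -> fcoord (fone : fibre R b) = 1.
Proof. by rewrite /fcoord /fone; case: b => // _; rewrite big_ord1 mxE. Qed.

Lemma fcoord_inj : injective (@fcoord R b).
Proof. by move=> x y xy; rewrite (fibreE x) xy -fibreE. Qed.

Lemma fcoord_zero_fibre x : ~~ b -> fcoord x = 0.
Proof. by rewrite /fcoord; case: b x => // x _; rewrite big_ord0. Qed.

Lemma fibre_closed_ball_compact (r : R) : 0 <= r ->
  compact [set x : fibre R b | complex.Re `|x| <= r].
Proof.
move=> r0.
have := @rV_compact R[i]^o b (fun=> [set z : R[i]^o | complex.Re `|z| <= r])
  (fun _ => @closed_disk_compact R r).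
congr (compact _); apply/seteqP.
split=> x /=; rewrite norm_fcoord /fcoord; case: b x => x.
- by move=> xr; rewrite big_ord1; exact: xr.
- by rewrite big_ord0 normr0.
- by rewrite big_ord1 => xr j; rewrite (ord1 j); exact: xr.
- by move=> _ [].
Qed.

(** A Cauchy filter contains a ball, and closed balls are compact. *)
Lemma fibre_cauchy_cvg (F : set_system (fibre R b)) :
  ProperFilter F -> cauchy F -> cvg F.
Proof.
move=> PF cF.
have /(_ 1 ltr01) [x Fx] := (@cauchyP _ (fibre R b) F PF).1 cF.
apply: (@compact_cauchy_cvg (fibre R b)
  [set y | complex.Re `|y| <= complex.Re `|x| + 1]) => //; last first.
  by apply: fibre_closed_ball_compact; rewrite norm_fcoord addr_ge0 // Re_norm_ge0.
move: Fx; rewrite /= -ball_normE; apply: filterS => y /= /ltW xy.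
have : `|y| <= `|x| + 1.
  by rewrite -lerBlDl (le_trans (lerB_dist _ _)) // distrC.
by rewrite lecE => /andP[_]; case: (`|x|).
Qed.

HB.instance Definition _ := Uniform_isComplete.Build (fibre R b) fibre_cauchy_cvg.

Definition fibre_inner x y : R[i] := fcoord x * ((fcoord y)^*)%C.

Lemma fibre_inner_linear (c : R[i]) (x y z : fibre R b) :
    fibre_inner (c *: x + y) z = c * fibre_inner x z + fibre_inner y z.
Proof. by rewrite /fibre_inner linearP mulrDl mulrA. Qed.

Lemma fibre_inner_conj x y : fibre_inner y x = (fibre_inner x y)^*.
Proof. by rewrite /fibre_inner rmorphM /= conjcK mulrC. Qed.

Lemma fibre_inner_norm x : fibre_inner x x = `|x| ^+ 2.
Proof. by rewrite /fibre_inner norm_fcoord sqr_normc. Qed.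

HB.instance Definition _ := CompleteNormedModule_isHilbert.Build R (fibre R b)
  fibre_inner_linear fibre_inner_conj fibre_inner_norm.

End Fibre.

(** * The space of ultrafilters *)

(** For discrete [X] this is the Stone-Cech compactification of [X]. *)
Definition ultrafilters (X : Type) := {F : set_system X | UltraFilter F}.

HB.instance Definition _ (X : Type) := gen_eqMixin (ultrafilters X).
HB.instance Definition _ (X : Type) := gen_choiceMixin (ultrafilters X).

Section StoneTopology.
Context {X : Type}.
Implicit Types (F G : ultrafilters X) (A B : set X) (O : set (ultrafilters X)).

Definition basic_clopen A : set (ultrafilters X) := [set F | sval F A].

Let stone_open O := forall F, O F -> exists2 A, sval F A & basic_clopen A `<=` O.

Lemma ultrafilterT F : sval F setT.
Proof. by case: F => F UF; exact: filterT. Qed.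

Lemma ultrafilterI F A B : sval F A -> sval F B -> sval F (A `&` B).
Proof. by case: F => F UF; exact: filterI. Qed.

Lemma ultrafilterS F A B : A `<=` B -> sval F A -> sval F B.
Proof. by case: F => F UF; exact: filterS. Qed.

Lemma ultrafilterC F A : sval F (~` A) <-> ~ sval F A.
Proof.
case: F => F UF /=; split=> [FnA FA|nFA].
  by have [x []] := filter_ex (filterI FA FnA).
by have [] := in_ultra_setVsetC A UF.
Qed.

Let stone_openT : stone_open setT.
Proof. by move=> F _; exists setT => //; exact: ultrafilterT. Qed.

Let stone_openI : setI_closed stone_open.
Proof.
move=> O V oO oV F [/oO[A FA AO] /oV[B FB BV]].
exists (A `&` B) => [|G GAB]; first exact: ultrafilterI.
by split; [apply: AO|apply: BV]; apply: ultrafilterS GAB => x [].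
Qed.

Let stone_open_bigU (I : Type) (O : I -> set (ultrafilters X)) :
  (forall i, stone_open (O i)) -> stone_open (\bigcup_i O i).
Proof.
move=> oO F [i _ /oO[A FA AO]]; exists A => // G /AO OG.
by exists i.
Qed.

HB.instance Definition _ := isOpenTopological.Build (ultrafilters X)
  stone_openT stone_openI stone_open_bigU.

Lemma stone_openP O :
  open O <-> forall F, O F -> exists2 A, sval F A & basic_clopen A `<=` O.
Proof. by []. Qed.

Lemma stone_nbhsP F O :
  nbhs F O <-> exists2 A, sval F A & basic_clopen A `<=` O.
Proof.
rewrite nbhsE; split=> [[V [oV VF] VO]|[A FA AO]].
  by have [A FA AV] := (stone_openP _).1 oV _ VF; exists A => //; exact: subset_trans VO.
exists (basic_clopen A) => //; split=> //.
by apply/stone_openP => G GA; exists A.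
Qed.

Lemma basic_clopen_clopen A : clopen (basic_clopen A).
Proof.
split; first by apply/stone_openP => F FA; exists A.
rewrite -openC; apply/stone_openP => F /ultrafilterC FA; exists (~` A) => //.
by move=> G /ultrafilterC.
Qed.

(** An ultrafilter [Phi] of ultrafilters converges to the ultrafilter of the
    sets [A] whose basic clopen set belongs to [Phi]. *)
Lemma ultrafilters_compact : compact [set: ultrafilters X].
Proof.
rewrite compact_ultra => Phi UPhi _.
pose F : set_system X := fun A => Phi (basic_clopen A).
have FF : ProperFilter F.
  apply: Build_ProperFilter_ex.
    move=> A; rewrite /F /= => /filter_ex[[G UG] /= GA]; exact: filter_ex GA.
  have PF : Filter Phi := @filter_filter _ _ (@ultra_proper _ _ UPhi).
  split=> [|A B FA FB|A B AB FA].
  - have PT : Phi setT by exact: filterT.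
    by apply: (@filterS _ Phi PF _ _ _ PT) => G _; exact: ultrafilterT.
  - apply: (@filterS _ Phi PF _ _ _ (@filterI _ Phi PF _ _ FA FB)) => G [GA GB].
    exact: ultrafilterI.
  - by apply: (@filterS _ Phi PF _ _ _ FA) => G; exact: ultrafilterS.
have UF : UltraFilter F.
  split=> // G PG FG; apply/seteqP; split=> // A GA.
  have [//|PnA] := in_ultra_setVsetC (basic_clopen A) UPhi.
  have /filter_ex[x []] // : G (A `&` ~` A).
  apply: filterI => //; apply: FG.
  by apply: (@filterS _ Phi _ _ _ _ PnA) => H /= /ultrafilterC.
exists (exist _ F UF); split=> // O /stone_nbhsP[A FA AO].
exact: (@filterS _ Phi _ _ _ AO).
Qed.

Lemma ultrafilters_hausdorff : hausdorff_space (ultrafilters X).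
Proof.
move=> F G FG; apply: eq_sig_hprop => [? ? ?|]; first exact: Prop_irrelevance.
have sub (F' G' : ultrafilters X) : cluster (nbhs F') G' -> sval F' `<=` sval G'.
  move=> cl A FA; apply: contrapT => /ultrafilterC GnA.
  have [||H [HA /ultrafilterC]] := cl (basic_clopen A) (basic_clopen (~` A)).
  - by apply/stone_nbhsP; exists A.
  - by apply/stone_nbhsP; exists (~` A).
  - exact.
apply/seteqP; split; apply: sub => // O V FO GV.
by rewrite setIC; exact: FG.
Qed.

Definition principal (x : X) : ultrafilters X :=
  exist _ (principal_filter x) (principal_filter_ultra x).

Lemma in_principal x A : sval (principal x) A <-> A x.
Proof. exact: principal_filterP. Qed.

Lemma principal_inj : injective principal.
Proof.
move=> x y xy; have /in_principal : sval (principal y) [set x].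
  by rewrite -xy; apply/in_principal.
by move=> ->.
Qed.

Lemma principal_dense : dense (range principal).
Proof.
move=> O [F OF] /stone_openP/(_ _ OF)[A FA AO].
have [x Ax] : exists x, A x by case: F FA {OF} => F UF; exact: filter_ex.
exists (principal x); split; last by exists x.
by apply: AO; apply/in_principal.
Qed.

(** The closure of an open [O] is the basic clopen set of the trace of [O] on
    the dense set of principal ultrafilters: any [F] not containing this trace
    has a neighbourhood without principal points of [O], hence disjoint from
    [O]. *)
Lemma ultrafilters_extremally_disconnected :
  extremally_disconnected (ultrafilters X).
Proof.
move=> O oO; pose B : set X := [set x | O (principal x)].
suff -> : closure O = basic_clopen B by have [] := basic_clopen_clopen B.
apply/seteqP; split=> F.
  move=> clF; apply: contrapT => /ultrafilterC nFB.
  have [|G [OG GnB]] := clF (basic_clopen (~` B)).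
    by apply/stone_nbhsP; exists (~` B).
  have oOB : open (O `&` basic_clopen (~` B)).
    by apply: openI oO _; have [] := basic_clopen_clopen (~` B).
  have [|H [[OH /ultrafilterC nHB] [x _ xE]]] := principal_dense _ oOB.
    by exists G.
  by apply: nHB; rewrite -xE; apply/in_principal; rewrite /B /= xE.
move=> FB V /stone_nbhsP[A FA AV].
have [x [Bx Ax]] : exists x, (B `&` A) x.
  by have := ultrafilterI FB FA; case: F {FB FA} => F UF; exact: filter_ex.
by exists (principal x); split=> //; apply: AV; apply/in_principal.
Qed.

Lemma principal_isolated x : [set principal x] = basic_clopen [set x].
Proof.
apply/seteqP; split=> [_ ->|F Fx]; first by apply/in_principal.
apply: eq_sig_hprop => [? ? ?|]; first exact: Prop_irrelevance.
apply: (@max_filter _ _ (principal_filter_ultra x)).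
  by case: F {Fx} => F UF; exact: ultra_proper.
by move=> A /principal_filterP Ax; apply: ultrafilterS Fx => _ ->.
Qed.

Lemma clopen_principal x : clopen [set principal x].
Proof. by rewrite principal_isolated; exact: basic_clopen_clopen. Qed.

End StoneTopology.

Lemma free_ultrafilter_exists :
  exists F : ultrafilters nat, forall n, F <> principal n.
Proof.
have [F [UF ooF]] := @ultraFilterLemma nat \oo _.
exists (exist _ F UF) => n /(congr1 sval) /= Fn.
have : F [set k | n < k]%N by apply: ooF; exact: nbhs_infty_gt.
by rewrite Fn => /principal_filterP /=; rewrite ltnn.
Qed.

(** * Operators on small fibres *)

Lemma eq_continuous (T U : topologicalType) (f g : T -> U) :
  f =1 g -> continuous f -> continuous g.
Proof. by move=> /funext ->. Qed.

Section OperatorNorm.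
Context {R : realType} {H : hilbertType R}.
Implicit Types (f : H -> H) (x y : H).

Lemma inner0r x : inner x 0 = 0.
Proof. by rewrite inner_conj inner0l conjc0. Qed.

Lemma opnorm0 f : (forall x, f x = 0) -> opnorm f = 0.
Proof.
move=> f0; rewrite /opnorm (_ : _ @` _ = [set 0]) ?sup1 //.
apply/seteqP; split=> [_ [x _ <-]|_ ->] /=; first by rewrite f0 /hnorm normr0.
by exists 0; rewrite ?f0 /hnorm /= normr0 ?ler01.
Qed.

Lemma opnorm_id_le1 : opnorm (id : H -> H) <= 1.
Proof.
apply: ge_sup; first by exists 0, 0; rewrite /= /hnorm normr0 ?ler01.
by move=> _ [x x1 <-].
Qed.

End OperatorNorm.

Lemma continuous_isolated (T U : topologicalType) (t0 : T) (f : T -> U) (v : U) :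
  clopen [set t0] -> (forall t, t != t0 -> f t = v) -> continuous f.
Proof.
move=> [ot0 ct0] fv t A.
have [-> /nbhs_singleton Af|tt0] := eqVneq t t0.
  apply: filterS (open_nbhs_nbhs (conj ot0 (erefl t0))).
  by move=> _ ->.
rewrite fv // => /nbhs_singleton Av.
have nt0 : (~` [set t0]) t by move=> tt; rewrite tt eqxx in tt0.
apply: filterS (open_nbhs_nbhs (conj (closed_openC ct0) nt0)).
by move=> s /eqP st0 /=; rewrite fv.
Qed.

Section FibreOperators.
Context {R : realType} {b : bool}.

Lemma fibre_hnorm (x : fibre R b) : hnorm x = complex.Re `|fcoord x|.
Proof. by rewrite /hnorm norm_fcoord. Qed.

Lemma scale_compact_op (k : R[i]) : compact_op (fun x : fibre R b => k *: x).
Proof.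
split; first by move=> c x y; rewrite scalerDr !scalerA mulrC.
exists [set x : fibre R b | complex.Re `|x| <= complex.Re `|k|].
  move=> _ [x /= x1 <-]; rewrite -/(hnorm _) hnormZ.
  by rewrite -[leRHS]mulr1 ler_wpM2l // Re_norm_ge0.
have K := @fibre_closed_ball_compact R b _ (Re_norm_ge0 k).
by split; [exact: K|apply: compact_closed K; exact: norm_hausdorff].
Qed.

(** A linear operator on a space of dimension at most 1 is a scalar. *)
Lemma linear_fibre_scale (f : fibre R b -> fibre R b) (x : fibre R b) :
  linear f -> f x = fcoord (f fone) *: x.
Proof.
move=> lf.
have fZ c y : f (c *: y) = c *: f y.
  have f0 : f 0 = 0 by have := lf (-1) 0 0; rewrite !scaleN1r oppr0 addr0 addNr.
  by have := lf c y 0; rewrite f0 !addr0.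
rewrite {1}(fibreE x) fZ (fibreE (f fone)) [in RHS](fibreE x).
by rewrite !scalerA mulrC -fibreE.
Qed.

End FibreOperators.

(** * A bundle whose Fell algebra has no unit *)

Section Counterexample.
Context {R : realType}.
Local Notation betaN := (ultrafilters nat).

Definition is_principal (s : betaN) : bool := `[< range principal s >].
Definition betaN_fibre (s : betaN) : hilbertType R := fibre R (is_principal s).

(** The coordinate is 0 over the free ultrafilters, so its continuity says that
    the sequence of coordinates at the principal points tends to 0. *)
Definition c0_sections : set (vfield betaN_fibre) :=
  [set w | continuous (fun s => fcoord (w s : fibre R (is_principal s)))].

Lemma is_principal_principal n : is_principal (principal n).
Proof. by apply/asboolP; exists n. Qed.

Definition point_field n (c : R[i]) : vfield betaN_fibre :=
  fun s => (if s == principal n then c else 0) *: (fone : fibre R _).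

Definition point_op n (c : R[i]) : opfield betaN_fibre :=
  fun s x => (if s == principal n then c else 0) *: x.

Arguments point_op : clear implicits.
Arguments point_field : clear implicits.

Lemma c0_sections_point_field n c : c0_sections (point_field n c).
Proof.
apply: (continuous_isolated (v := 0) (clopen_principal n)) => s /negbTE sn.
by rewrite /point_field sn scale0r linear0.
Qed.

Lemma c0_sections_bundle : continuous_hilbert_bundle c0_sections.
Proof.
split.
- apply: (eq_continuous _ (@cst_continuous _ R[i]^o 0)) => s.
  by rewrite linear0.
- move=> w1 w2 c1 c2; apply: (eq_continuous _ (complex_continuousD c1 c2)) => s.
  by rewrite linearD.
- move=> f w cf cw; apply: (eq_continuous _ (complex_continuousM cf cw)) => s.
  by rewrite linearZ.
- move=> s x.
  have [/asboolP[n _ ns]|nP] := boolP (is_principal s).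
    subst s; exists (point_field n (fcoord (x : fibre R _))).
      exact: c0_sections_point_field.
    by rewrite /point_field eqxx -fibreE.
  exists (point_field 0 0); first exact: c0_sections_point_field.
  by apply: fcoord_inj; rewrite !fcoord_zero_fibre.
- move=> w cw; apply: (eq_continuous _ (complex_continuous_norm cw)) => s.
  by rewrite -fibre_hnorm.
- move=> xi xiP; apply: local_uniform_limit_continuous => s0 e e0.
  have [U [w [oU Us0 ww wU]]] := xiP s0 e e0.
  exists U, (fun s => fcoord (w s : fibre R _)); split=> // s /wU.
  by rewrite fibre_hnorm linearB.
Qed.

(** Finite-dimensional approximation is exact: the span of the point field near
    the isolated point, and the span of the empty family elsewhere. *)
Lemma fell_point_op n c : fell c0_sections (point_op n c).
Proof.
have point_op0 s : s != principal n -> forall x, point_op n c s x = 0.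
  by move=> /negbTE sn x; rewrite /point_op sn scale0r.
split=> [s|||s e e0].
- exact: scale_compact_op.
- apply: (continuous_isolated (v := 0) (clopen_principal n)) => s sn.
  exact/opnorm0/point_op0.
- move=> w1 w2 _ _.
  apply: (continuous_isolated (v := 0) (clopen_principal n)) => s sn.
  by rewrite point_op0 // inner0l.
have [->|sn] := eqVneq s (principal n).
  exists [set principal n], 1%N, (fun=> point_field n 1), (fun s x => x).
  split=> //.
  - by have [] := clopen_principal n.
  - by move=> _; exact: c0_sections_point_field.
  move=> _ ->; split.
  - move=> k; rewrite big_ord1 /point_field eqxx scale1r => k0 j.
    have := congr1 fcoord k0.
    rewrite linearZ linear0 /= fcoord_one ?is_principal_principal //.
    by rewrite [_ *: _]mulr1 (ord1 j) => k00; exact: k00.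
  - move=> x; split=> [|y _]; last by rewrite subrr inner0l.
    exists (fun=> fcoord (x : fibre R _)).
    by rewrite big_ord1 /point_field eqxx scale1r -fibreE.
  - by rewrite opnorm0 // => x; rewrite subrr.
exists (~` [set principal n]), 0%N, (fun=> point_field n 0), (fun s x => 0).
split=> //.
- by apply: closed_openC; have [] := clopen_principal n.
- exact/eqP.
- by case.
move=> t tn0; have tn : t != principal n by exact/eqP.
split=> [k _ []|x|] //.
  split=> [|y [k ->]]; last by rewrite big_ord0 inner0r.
  by exists (fun=> 0); rewrite big_ord0.
by rewrite opnorm0 // => x; rewrite point_op0 // subr0.
Qed.

Lemma restr_point_op1 n (s : [set principal n]) :
  restr_opfield (point_op n 1) s = id.
Proof.
apply/funext => x; rewrite /restr_opfield /point_op.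
have -> : set_val s == principal n by apply/eqP; exact: set_mem (valP s).
by rewrite scale1r.
Qed.

(** The identities over the single points form a unit of the sum.  Its preimage
    [u] acts as the identity over each principal ultrafilter, so its norm is 1
    on a dense set; but the norm of [u] is continuous and is 0 over a free
    ultrafilter, where the fibre is zero. *)
Lemma fell_c0_sections_not_isomorphic_sum :
  ~ star_isomorphic (fell_algebra c0_sections)
   (linf_sum (fun n : nat =>
      fell_algebra (restr_bundle [set principal n] c0_sections))).
Proof.
move=> [phi [[phiS phiI phiO] _ _ phiM _]].
pose e : forall n, opfield (@restr_fibres R _ betaN_fibre [set principal n]) :=
  fun n => restr_opfield (point_op n 1).
have /phiO[u fu phiu] : sa_set (linf_sum (fun n : nat =>
    fell_algebra (restr_bundle [set principal n] c0_sections))) e.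
  split=> [n|]; first exact/fell_restr/fell_point_op.
  exists 1 => n; apply: ge_sup.
    pose s : [set principal n : betaN] :=
      exist _ (principal n) (mem_set (erefl _ : [set principal n] (principal n))).
    by exists (opnorm (e n s)), s.
  by move=> _ [s _ <-]; rewrite /e restr_point_op1 opnorm_id_le1.
have [ku cu _ _] := fu.
have u1 n : opnorm (u (principal n)) = 1.
  (* Over the point [principal n], [u] is a scalar c.  The product of [u] with
     the point operator is then the point operator of value c, visibly in the
     Fell algebra, and injectivity of [phi] forces c = 1. *)
  pose c := fcoord (u (principal n) (fone : fibre R _) : fibre R _).
  have uc : sa_mul (u : sa_sort (fell_algebra c0_sections)) (point_op n 1) =
      point_op n c.
    apply: functional_extensionality_dep => s; apply/funext => x /=.
    rewrite /point_op; case: eqVneq => [sn|sn].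
      subst s; rewrite scale1r; apply: linear_fibre_scale; exact: (ku _).1.
    rewrite !scale0r (linear_fibre_scale _ (ku s).1) scaler0 //.
  have : phi (point_op n c) = phi (point_op n 1).
    apply: (etrans (congr1 phi (esym uc))).
    apply: (etrans (phiM _ _ fu (fell_point_op n 1))).
    rewrite phiu; apply: functional_extensionality_dep => m.
    apply: functional_extensionality_dep => s; apply/funext => x /=.
    by rewrite /e restr_point_op1.
  move=> /(phiI _ _ (mem_set (fell_point_op n c)) (mem_set (fell_point_op n 1))).
  move=> /(congr1 (fun a : opfield betaN_fibre =>
    fcoord (a (principal n) (fone : fibre R _) : fibre R _))).
  rewrite /point_op eqxx !linearZ /= fcoord_one ?is_principal_principal //.
  rewrite [_ *: _]mulr1 [X in _ = X]mulr1 => c1.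
  have -> : u (principal n) = id.
    apply/funext => x; rewrite (linear_fibre_scale _ (ku _).1) -/c c1 scale1r //.
  apply/eqP; rewrite eq_le opnorm_id_le1 /=.
  apply: ub_le_sup.
    by exists 1 => _ [x x1 <-].
  have h1 : hnorm (fone : fibre R (is_principal (principal n))) = 1.
    by rewrite fibre_hnorm fcoord_one ?is_principal_principal // normr1.
  by exists fone => //=; rewrite h1.
have [F Ffree] := free_ultrafilter_exists.
have nF : ~~ is_principal F by apply/asboolP => -[n _ nF]; exact: (Ffree n).
have uF : opnorm (u F) = 0.
  by apply: opnorm0 => x; apply: fcoord_inj; rewrite !fcoord_zero_fibre.
have := cu F; move=> /cvgrPdist_lt/(_ 1 ltr01); rewrite uF.
rewrite nbhsE => -[V [oV VF] VP].
have [|G [VG [n _ nG]]] := principal_dense _ oV; first by exists F.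
have /= := VP _ VG; rewrite -nG u1 sub0r normrN normr1 ltxx //.
Qed.

Lemma principal_disjoint_clopen_dense :
  disjoint_clopen_dense (fun n : nat => [set principal n : betaN]).
Proof.
split; first exact: clopen_principal.
  by move=> m n _ _ [F [/= -> mn]]; exact: principal_inj.
move=> O O0 oO; have [F [OF [n _ nF]]] := principal_dense O0 oO.
by exists F; split=> //; exists n.
Qed.

End Counterexample.

Theorem proposition5p5 (R : realType) :
  (forall (T : topologicalType) (H : T -> hilbertType R)
     (Om : set (vfield H)) (I : Type) (D : I -> set T)
     (rho : sa_sort (wk_algebra Om) ->
            sa_sort (linf_sum (fun i => wk_algebra (restr_bundle (D i) Om)))),
     stonean T -> continuous_hilbert_bundle Om -> disjoint_clopen_dense D ->
     star_isomorphism rho ->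
     (forall b, sa_set (wk_algebra Om) b ->
        forall i (nu : wk_module Om),
          rho b i (wk_restr (D i) nu) = wk_restr (D i) (b nu)) ->
     forall b, sa_set (fell_subalgebra Om) b ->
       sa_set (linf_sum (fun i => fell_subalgebra (restr_bundle (D i) Om)))
              (rho b)) /\
  (exists (T : topologicalType) (H : T -> hilbertType R)
     (Om : set (vfield H)) (I : Type) (D : I -> set T),
     [/\ stonean T, continuous_hilbert_bundle Om, disjoint_clopen_dense D
       & ~ star_isomorphic (fell_algebra Om)
             (linf_sum (fun i => fell_algebra (restr_bundle (D i) Om)))]).
Proof.
split; first by move=> T H Om I D rho _ _ [cD _ _]; exact: restriction_map_fell.
exists (ultrafilters nat), betaN_fibre, c0_sections, nat.
exists (fun n => [set principal n]).
split.
- by split; [exact: ultrafilters_compact|exact: ultrafilters_hausdorff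
            |exact: ultrafilters_extremally_disconnected].
- exact: c0_sections_bundle.
- exact: principal_disjoint_clopen_dense.
- exact: fell_c0_sections_not_isomorphic_sum.
Qed.
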